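(* For every integer $d\ge 0$, $$E_d^+ = \sum_{k=0}^d H_{d-2k}\,E_{k^2},$$ where $H_i=E_i=0$ for $i<0$. Here $k^2$ denotes the block of degree $k$ and multiplicity $2$ (not exponentiation).
   Context: Let $x_{i,j}$ ($i,j\ge 1$) be indeterminates with $\deg x_{i,j}=i$; all series have rational coefficients. A monomial is square-free if every exponent is at most $1$. For $d\ge 0$: $H_d$ is the sum of all monomials of degree $d$; $E^+_d$ is the sum of all square-free monomials of degree $d$; $E_d$ is the sum over square-free monomials $f$ of degree $d$ of $(-1)^{m(f)}f$, where $m(f)$ is the number of indeterminates in $f$. In particular $H_0=E_0=E_0^+=1$. For $k\ge 0$, $E_{k^2}$ is the series obtained from $E_k$ by replacing each $x_{i,j}$ by $x_{i,j}^2$ (so $E_{0^2}=1$). *)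

(* Defs.v *)
From HB Require Import structures.
From mathcomp Require Import all_boot all_order all_algebra finmap.
From mathcomp Require Import boolp classical_sets functions cardinality fsbigop.
From mathcomp.multinomials Require Export monalg.

Set Implicit Arguments.
Unset Strict Implicit.
Unset Printing Implicit Defensive.

Import Order.TTheory GRing.Theory Num.Theory.

Local Open Scope classical_set_scope.
Local Open Scope ring_scope.

(* The pair (i, j) with i, j >= 1 stands for the indeterminate x_{i,j}. *)
Definition var : choiceType := {p : nat * nat | (0 < p.1)%N && (0 < p.2)%N}.

Definition var_deg (v : var) : nat := (val v).1.

Definition monom := {cmonom var}.

(* This is the degree for deg x_{i,j} = i, not the library's [mdeg], in which
   every indeterminate has degree 1. *)
Definition wdeg (m : monom) : nat := (\sum_(v <- finsupp m) m v * var_deg v)%N.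

Definition squarefree (m : monom) : bool :=
  all (fun v => m v <= 1)%N (finsupp m).

Definition nvars (m : monom) : nat := #|` finsupp m|.

(* A formal power series is its family of coefficients; infinitely many
   monomials may occur, even in a single degree. Addition is the pointwise one
   inherited from the function type; the pointwise product is deliberately not
   inherited, as the product of series is [mulS] below. *)
Definition series := monom -> rat.

HB.instance Definition _ := GRing.Zmodule.copy series (monom -> rat).

(* The Cauchy product; the sum is finite by [finite_factors]. *)
Definition mulS (f g : series) : series := fun m =>
  \sum_(p \in [set p : monom * monom | mmul p.1 p.2 = m]) f p.1 * g p.2.

Notation "f *S g" := (mulS f g)
  (at level 40, left associativity) : ring_scope.

(* The result of replacing every x_{i,j} by x_{i,j}^2 in the monomial m. *)
Definition sq_monom (m : monom) : monom :=
  [cmonom 2 * m v | v in finsupp m]%M.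

(* The same substitution in a series: each term c m becomes c (sq_monom m). The
   sum has at most one term by [sq_monom_inj]. *)
Definition sq_subst (f : series) : series := fun m =>
  \sum_(n \in [set n : monom | sq_monom n = m]) f n.

(* The degree d is an integer, and the series below vanish for d < 0. *)
Definition H (d : int) : series := fun m => ((wdeg m)%:Z == d)%:R.

Definition Eplus (d : int) : series := fun m =>
  (((wdeg m)%:Z == d) && squarefree m)%:R.

Definition E (d : int) : series := fun m =>
  if ((wdeg m)%:Z == d) && squarefree m then (-1) ^+ nvars m else 0.

(* E_{k^2} *)
Definition Esq (k : nat) : series := sq_subst (E k).

Lemma finite_factors (m : monom) :
  finite_set [set p : monom * monom | mmul p.1 p.2 = m].
Proof.
pose g (h : {ffun finsupp m -> 'I_(mdeg m).+1}) : monom * monom :=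
  let m1 := [cmonom (h v : nat) | v : finsupp m]%M in (m1, divcm m m1).
apply: (@sub_finite_set _ _ (g @` setT)); last first.
  exact/finite_image/finite_finset.
move=> [m1 m2] /= mE.
pose h : {ffun finsupp m -> 'I_(mdeg m).+1} := [ffun v => inord (m1 (val v))].
exists h => //.
have m1E : [cmonom (h v : nat) | v : finsupp m]%M = m1.
  apply/eqP/cmP => v; rewrite cmE fsfun_ffun.
  case: insubP => [u vm uE|vm].
    rewrite /= /h ffunE uE inordK// ltnS -mE mdegM (leq_trans _ (leq_addr _ _))//.
    rewrite mdegE; case: (mdomP m1 v) => // v1.
    by rewrite (big_fsetD1 v) //= leq_addr.
  have : m v == 0%N by rewrite cmE_eq0.
  by rewrite -{1}mE cmM addn_eq0 => /andP[/eqP].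
rewrite /g m1E; congr pair.
by apply/eqP/cmP => v; rewrite -mE divcmE cmM addKn.
Qed.

Lemma sq_monomE (m : monom) v : sq_monom m v = (2 * m v)%N.
Proof. by rewrite cmE fsfun_fun; case: finsuppP => // ->. Qed.

Lemma sq_monom_inj : injective sq_monom.
Proof.
move=> m n mn; apply/eqP/cmP => v; apply/eqP.
by rewrite -(eqn_pmul2l (isT : 0 < 2)%N) -!sq_monomE mn.
Qed.

Lemma H_neg (d : int) : d < 0 -> H d = 0.
Proof.
move=> d0; apply/funext => m; rewrite /H; case: eqP => // dE.
by rewrite -dE in d0.
Qed.

Lemma E_neg (d : int) : d < 0 -> E d = 0.
Proof.
move=> d0; apply/funext => m; rewrite /E; case: eqP => // dE.
by rewrite -dE in d0.
Qed.

(* Main.v *)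
Require Import Defs.
From mathcomp Require Import all_boot all_order all_algebra.
From mathcomp Require Import finmap boolp classical_sets functions.
From mathcomp Require Import cardinality fsbigop zify.

Set Implicit Arguments.
Unset Strict Implicit.
Unset Printing Implicit Defensive.

Import GRing.Theory Num.Theory.

Local Open Scope ring_scope.

(* Comparing coefficients at a monomial [m] of degree [d], the right-hand side
   counts, with sign [(-1) ^+ nvars n], the square-free monomials [n] whose
   square divides [m]. These [n] are the indicators of the subsets of the set
   of indeterminates of exponent at least 2 in [m], so the alternating sum is
   1 if that set is empty, i.e. if [m] is square-free, and 0 otherwise. *)

(** Degrees of monomials with different supports can be compared term by term once they are summed
    over a common finite set. *)
Lemma wdeg_widen (D : {fset var}) (m : monom) :
  (finsupp m `<=` D)%fset -> wdeg m = (\sum_(v <- D) m v * var_deg v)%N.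
Proof.
move=> mD; apply: big_fset_incl => // v _.
by rewrite -cmE_eq0 => /eqP->.
Qed.

Lemma wdegM (m n : monom) : wdeg (mmul m n) = (wdeg m + wdeg n)%N.
Proof.
pose D := (finsupp m `|` finsupp n)%fset.
rewrite !(@wdeg_widen D) ?fsubsetUl ?fsubsetUr//.
  by rewrite -big_split; apply: eq_bigr => v _; rewrite cmM mulnDl.
apply/fsubsetP => v; rewrite in_fsetU -!cmE_neq0 cmM; lia.
Qed.

Lemma wdeg_sq (m : monom) : wdeg (sq_monom m) = (2 * wdeg m)%N.
Proof.
rewrite (@wdeg_widen (finsupp m)).
  by rewrite big_distrr; apply: eq_bigr => v _; rewrite sq_monomE -mulnA.
apply/fsubsetP => v; rewrite -!cmE_neq0 sq_monomE; lia.
Qed.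

Lemma sq_subst_sq (f : series) (n : monom) : sq_subst f (sq_monom n) = f n.
Proof.
transitivity (\sum_(x \in [set n]%classic) f x); last exact: fsbig_set1.
apply: eq_fsbigl.
by apply/seteqP; split => x /= => [/sq_monom_inj|->].
Qed.

Lemma sq_subst_neq0 (f : series) (m : monom) :
  sq_subst f m != 0 -> exists2 n, m = sq_monom n & f n != 0.
Proof.
case: (pselect (exists n, m = sq_monom n)) => [[n ->]|mn].
  by rewrite sq_subst_sq; exists n.
rewrite /sq_subst fsbig1 ?eqxx// => n /= nm.
by case: mn; exists n.
Qed.

(** Taking [J] as a set over the finite type attached to [S] makes the alternating sum over subsets
    a sum over a finite type. *)
Definition indicator (S : {fset var}) (J : {set S}) : monom :=
  [cmonom ((v \in J) : nat) | v : S]%M.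

Lemma indicatorE (S : {fset var}) (J : {set S}) (v : S) :
  indicator J (val v) = (v \in J).
Proof. by rewrite cmE fsfun_ffun valK. Qed.

Lemma indicator_out (S : {fset var}) (J : {set S}) (v : var) :
  v \notin S -> indicator J v = 0%N.
Proof. by move=> vS; rewrite cmE fsfun_ffun insubN. Qed.

Lemma indicator_le1 (S : {fset var}) (J : {set S}) (v : var) :
  (indicator J v <= 1)%N.
Proof.
have [vS|/indicator_out->//] := boolP (v \in S).
by rewrite (indicatorE J [` vS]%fset) leq_b1.
Qed.

Lemma indicator_inj (S : {fset var}) : injective (@indicator S).
Proof.
move=> J K JK; apply/setP => v; have := indicatorE J v.
by rewrite JK indicatorE; do 2!case: (v \in _).
Qed.

Lemma squarefree_indicator (S : {fset var}) (J : {set S}) :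
  squarefree (indicator J).
Proof. by apply/allP => v _; apply: indicator_le1. Qed.

Lemma nvars_indicator (S : {fset var}) (J : {set S}) :
  nvars (indicator J) = #|J|.
Proof.
have sub : (finsupp (indicator J) `<=` S)%fset.
  apply/fsubsetP => v; apply: contraLR => /indicator_out.
  by rewrite -cmE_eq0 => ->.
(* All exponents on the support are 1, so the number of indeterminates is the sum of the exponents,
   which extends to all of [S]. *)
transitivity (\sum_(v <- finsupp (indicator J)) indicator J v)%N.
  rewrite /nvars cardfE -sum1_card big_seq_fsetE.
  apply: eq_bigr => v _; apply/esym/eqP.
  by rewrite eqn_leq indicator_le1 lt0n cmE_neq0 (valP v).
rewrite (big_fset_incl _ sub) => [|v _]; last by rewrite -cmE_eq0 => /eqP.
rewrite big_seq_fsetE -sum1_card [RHS]big_mkcond /=.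
by apply: eq_bigr => v _; rewrite indicatorE; case: (v \in J).
Qed.

Lemma squarefree_is_indicator (S : {fset var}) (n : monom) :
  squarefree n -> (finsupp n `<=` S)%fset ->
  n = indicator [set v : S | n (val v) == 1%N]%SET.
Proof.
move=> /allP n1 nS; apply/eqP/cmP => v.
have [vS|vS] := boolP (v \in S).
  rewrite (indicatorE _ [` vS]%fset) inE /=.
  by case: finsuppP => // /n1; case: (n v) => [|[]].
rewrite indicator_out//; apply/eqP; rewrite cmE_eq0.
by apply: contra vS => /(fsubsetP nS).
Qed.

Definition multiple_vars (m : monom) : {fset var} :=
  [fset v in finsupp m | (1 < m v)%N]%fset.

Lemma mem_multiple_vars (m : monom) v :
  (v \in multiple_vars m) = (1 < m v)%N.
Proof. by rewrite !inE -cmE_neq0; lia. Qed.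

(** No exponent is truncated in the division: the square has exponents at most 2, nonzero only where
    [m] has exponent at least 2. *)
Lemma mulcm_divcmK (m : monom) (J : {set multiple_vars m}) :
  mmul (divcm m (sq_monom (indicator J))) (sq_monom (indicator J)) = m.
Proof.
apply/eqP/cmP => v; rewrite cmM divcmE subnK// sq_monomE.
have [vm|/indicator_out->//] := boolP (v \in multiple_vars m).
by have := indicator_le1 J v; move: vm; rewrite mem_multiple_vars; lia.
Qed.

(** The degree condition stays inside [E k], so that the index set does not depend on [k] and the
    two sums can later be exchanged. *)
Lemma mulS_Esq (f : series) (k : nat) (m : monom) :
  (f *S Esq k) m = \sum_(J : {set multiple_vars m})
    f (divcm m (sq_monom (indicator J))) * E k (indicator J).
Proof.
pose h (J : {set multiple_vars m}) :=
  (divcm m (sq_monom (indicator J)), sq_monom (indicator J)).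
have hinj : set_inj setT h by move=> J K _ _ [_ /sq_monom_inj/indicator_inj].
transitivity (\sum_(p \in (h @` setT)%classic) f p.1 * Esq k p.2).
  (* If the term of a factorization [(a, b)] of [m] is nonzero, then [b] is the square of a
     square-free [n]. Each indeterminate of [n] has exponent at least 2 in [m], so [n] is an
     indicator, and [a] is the quotient. *)
  apply/esym/fsbig_widen => [p [J _ <-]|[a b] /= [abm hab]].
    exact: mulcm_divcmK.
  apply: contra_notP hab => /eqP; rewrite mulf_eq0 negb_or => /andP[_].
  move=> /sq_subst_neq0[n bE]; rewrite /E.
  case: ifP => [/andP[_ sqn] _|]; last by rewrite eqxx.
  have nm : (finsupp n `<=` multiple_vars m)%fset.
    apply/fsubsetP => v; rewrite mem_multiple_vars -cmE_neq0.
    by rewrite -abm cmM bE sq_monomE; lia.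
  exists [set v | n (val v) == 1%N]%SET => //.
  rewrite /h -squarefree_is_indicator// -bE; congr pair.
  by apply/eqP/cmP => v; rewrite -abm divcmE cmM addnK.
rewrite fsbig_image//.
transitivity (\sum_(J \in [set: {set multiple_vars m}])
    f (divcm m (sq_monom (indicator J))) * E k (indicator J)).
  by apply: eq_fsbigr => J _; rewrite /= /Esq sq_subst_sq.
rewrite [RHS]fsbig_seq ?index_enum_uniq//; apply: eq_fsbigl.
by apply/seteqP; split => J //= _; rewrite mem_index_enum.
Qed.

(** Expand the product of [-1 + 1] over [I]: it vanishes unless [I] is empty, when it is the empty
    product 1. *)
Lemma sum_sign_subsets (R : comNzRingType) (I : finType) :
  \sum_(J : {set I}) (-1) ^+ #|J| = (#|I| == 0%N)%:R :> R.
Proof.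
transitivity (\prod_(i : I) (-1 + 1) : R).
  rewrite bigA_distr; apply: eq_big => // J _.
  by rewrite -big_mkcond prodr_const.
by rewrite addNr prodr_const expr0n.
Qed.

Lemma squarefree_multiple_vars (m : monom) :
  squarefree m = (multiple_vars m == fset0)%fset.
Proof.
apply/allP/eqP => [m1|m0 v _].
  apply/fsetP => v; rewrite mem_multiple_vars in_fset0.
  by apply/negbTE; rewrite -leqNgt; case: finsuppP => // /m1.
by rewrite leqNgt -mem_multiple_vars m0 in_fset0.
Qed.

Theorem proposition23 (d : nat) :
  Eplus d%:Z = \sum_(0 <= k < d.+1) H (d%:Z - 2 * k%:Z) *S Esq k.
Proof.
apply/funext => m.
have -> : (\sum_(0 <= k < d.+1) H (d%:Z - 2 * k%:Z) *S Esq k) m =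
    \sum_(0 <= k < d.+1) (H (d%:Z - 2 * k%:Z) *S Esq k) m.
  by elim/big_rec2: _ => // k x y _ <-.
under eq_bigr do rewrite mulS_Esq.
rewrite exchange_big /= /Eplus squarefree_multiple_vars -mulnb natrM.
(* The square-free condition in [Eplus] is itself expanded as a signed sum over [J], so the two
   sides are compared for each [J] separately. *)
rewrite -cardfs_eq0 cardfE -sum_sign_subsets mulr_sumr; apply: eq_bigr => J _.
have := congr1 wdeg (mulcm_divcmK J); rewrite wdegM wdeg_sq => mE.
rewrite /H /E squarefree_indicator nvars_indicator.
set w := wdeg (divcm _ _) in mE *; set n := wdeg (indicator J) in mE *.
(* For fixed [J], the factor [E k] leaves only the index [k = n]. *)
transitivity (\sum_(0 <= k < d.+1 | k == n)
    (w%:Z == d%:Z - 2 * k%:Z)%:R * (-1) ^+ #|J| : rat).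
  (* When [n > d] this index is out of range, but the left side is 0 as well, since [m] has degree
     [w + 2 * n > d]. *)
  rewrite big_nat1_eq -mE ltnS /=; case: leqP => nd.
    by congr (_%:R * _); congr nat_of_bool; lia.
  by case: eqP => [|_]; [lia|rewrite mul0r].
rewrite big_mkcond; apply: eq_bigr => k _; rewrite andbT eqz_nat eq_sym.
by case: eqP => _ //; rewrite mulr0.
Qed.
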